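(* Let $k\ge2$, let $L:\mathbb{R}^{k-1}\to\mathbb{R}$ be a linear form, and let $Y$ be a $k$ to $k-1$ cubical or canonical cut and project set with physical space $E=\{(x,L(x)):x\in\mathbb{R}^{k-1}\}$. Then $Y$ is linearly repetitive if and only if $L$ is badly approximable, i.e. there exists a constant $C>0$ such that $\|L(n)\|\ge C/|n|^{k-1}$ for all $n\in\mathbb{Z}^{k-1}\setminus\{0\}$.
   Context: $\|\cdot\|$ denotes the distance to the nearest integer and $|\cdot|$ the maximum norm. Cut and project sets (here $d=k-1$). Let $E=\{(x,L(x)):x\in\mathbb{R}^d\}\subseteq\mathbb{R}^k$ with $L:\mathbb{R}^d\to\mathbb{R}^{k-d}$ linear (the physical space), and let $F_\pi\subseteq\mathbb{R}^k$ be a subspace complementary to $E$ (the internal space). Let $\pi:\mathbb{R}^k\to E$ be the projection onto $E$ with respect to $\mathbb{R}^k=E+F_\pi$; it is assumed that $\pi|_{\mathbb{Z}^k}$ is injective. Let $F_\rho=\{0\}\times\mathbb{R}^{k-d}$, and let $\rho:\mathbb{R}^k\to E$ and $\rho^*:\mathbb{R}^k\to F_\rho$ be the projections with respect to $\mathbb{R}^k=E+F_\rho$. Given a window $\mathcal{W}\subseteq F_\rho$, the strip is $\mathcal{S}=\mathcal{W}+E$, and for $s\in\mathbb{R}^k/\mathbb{Z}^k$ the $k$ to $d$ cut and project set is $Y=Y_s=\pi(\mathcal{S}\cap(\mathbb{Z}^k+s))\subseteq E$. It is regular if $(\mathbb{Z}^k+s)\cap\partial\mathcal{S}=\emptyset$;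 totally irrational if the image of $E$ in $\mathbb{R}^k/\mathbb{Z}^k$ is dense; aperiodic if the only $x\in E$ with $Y+x=Y$ is $x=0$. The cubical window is $\mathcal{W}=\{\sum_{i=d+1}^k t_ie_i:0\le t_i<1\}$; the canonical window is the image under $\rho^*$ of the unit cube in $\mathbb{R}^k$. A cubical (resp. canonical) cut and project set is a regular, totally irrational, aperiodic cut and project set with the cubical (resp. canonical) window. Linear repetitivity. For $y\in Y$ let $\tilde y$ be the unique point of $\mathcal{S}\cap(\mathbb{Z}^k+s)$ with $\pi(\tilde y)=y$. Fix a bounded convex $\Omega\subseteq E$ containing a neighborhood of $0$ in $E$. The patch of size $r$ at $y\in Y$ is $P(y,r)=\{y'\in Y:\rho(\tilde{y'}-\tilde y)\in r\Omega\}$; patches $P(y_1,r)$ and $P(y_2,r)$ are equivalent if $P(y_1,r)=P(y_2,r)+y_1-y_2$. $Y$ is linearly repetitive if there is $C>0$ such that for every $r\ge1$ and every $y\in Y$, every ball of diameter $Cr$ in $E$ contains a point $y'\in Y$ with $P(y',r)$ equivalent to $P(y,r)$. (This property does not depend on the choice of $\Omega$.) *)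

(* Defs.v *)
From HB Require Import structures.
From mathcomp Require Import all_boot all_order all_algebra.
From mathcomp Require Import all_classical all_reals all_analysis.
Set Implicit Arguments.
Unset Strict Implicit.
Unset Printing Implicit Defensive.
Import Order.TTheory GRing.Theory Num.Theory.
Import numFieldNormedType.Exports.
Local Open Scope classical_set_scope.
Local Open Scope ring_scope.
Local Open Scope quotient_scope.

Section Torus.
Variables (R : realType) (n : nat).

Definition torus_rel : rel 'rV[R]_n := fun u v => u - v \is a mxOver Num.int.

Lemma torus_rel_refl : reflexive torus_rel.
Proof. by move=> u; rewrite /torus_rel subrr mxOver0// rpred0. Qed.

Lemma torus_rel_sym : symmetric torus_rel.
Proof.
move=> u v; apply/mxOverP/mxOverP => uvZ i j;
  by have := uvZ i j; rewrite !mxE -opprB rpredN.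
Qed.

Lemma torus_rel_trans : transitive torus_rel.
Proof.
move=> v u w /mxOverP uv /mxOverP vw; apply/mxOverP => i j.
have := uv i j; have := vw i j; rewrite !mxE => vwij uvij.
by rewrite -(subrKA (v i j)) rpredD.
Qed.

Canonical torus_equiv :=
  EquivRel torus_rel torus_rel_refl torus_rel_sym torus_rel_trans.

Definition torus := quotient_topology {eq_quot torus_equiv}.

HB.instance Definition _ := Topological.on torus.
HB.instance Definition _ := Quotient.on torus.

(* Z^n + s, for a class s in R^n / Z^n *)
Definition coset (s : torus) : set 'rV[R]_n := [set v | \pi_torus v = s].

Lemma cosetE (v0 : 'rV[R]_n) :
  coset (\pi_torus v0) =
  [set z + v0 | z in [set z : 'rV[R]_n | z \is a mxOver Num.int]].
Proof.
rewrite /coset; apply/seteqP; split=> v /=.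
  move=> /(@eqmodP _ torus_equiv) vv0.
  by exists (v - v0); rewrite ?subrK.
case=> z zZ <-; apply: (elimT (@eqmodP _ torus_equiv _ _)).
by rewrite /= /torus_rel addrK.
Qed.

End Torus.

Section Subspaces.
Variables (R : realType) (d m : nat).

Definition graph_map (L : 'rV[R]_d -> 'rV[R]_m) (x : 'rV[R]_d) :
  'rV[R]_(d + m) := row_mx x (L x).

Fact graph_map_is_linear (L : {linear 'rV[R]_d -> 'rV[R]_m}) :
  linear (graph_map L).
Proof.
by move=> a x y; rewrite /graph_map linearP scale_row_mx add_row_mx.
Qed.

HB.instance Definition _ (L : {linear 'rV[R]_d -> 'rV[R]_m}) :=
  GRing.isLinear.Build R 'rV[R]_d 'rV[R]_(d + m) _ (graph_map L)
    (graph_map_is_linear L).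

(* E = {(x, L x)} *)
Definition physical (L : {linear 'rV[R]_d -> 'rV[R]_m}) :
  {vspace 'rV[R]_(d + m)} := limg (linfun (graph_map L)).

Lemma physicalP (L : {linear 'rV[R]_d -> 'rV[R]_m}) (v : 'rV[R]_(d + m)) :
  v \in physical L <-> exists x, v = row_mx x (L x).
Proof.
split=> [/memv_imgP[x _ ->]|[x ->]]; first by exists x; rewrite lfunE.
by apply/memv_imgP; exists x; rewrite ?memvf// lfunE.
Qed.

Fact row_mx0_is_linear : linear (@row_mx R 1 d m 0).
Proof. by move=> a x y; rewrite scale_row_mx add_row_mx scaler0 addr0. Qed.

HB.instance Definition _ :=
  GRing.isLinear.Build R 'rV[R]_m 'rV[R]_(d + m) _ (@row_mx R 1 d m 0)
    row_mx0_is_linear.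

(* F_rho = {0} x R^m *)
Definition reference : {vspace 'rV[R]_(d + m)} :=
  limg (linfun (@row_mx R 1 d m 0)).

Lemma referenceP (v : 'rV[R]_(d + m)) :
  v \in reference <-> exists t, v = row_mx 0 t.
Proof.
split=> [/memv_imgP[x _ ->]|[x ->]]; first by exists x; rewrite lfunE.
by apply/memv_imgP; exists x; rewrite ?memvf// lfunE.
Qed.

Lemma physical_reference_compl (L : {linear 'rV[R]_d -> 'rV[R]_m}) :
  (physical L + reference = fullv)%VS /\ (physical L :&: reference = 0)%VS.
Proof.
split.
  apply/eqP; rewrite eqEsubv subvf; apply/subvP => v _.
  rewrite -[v]hsubmxK (_ : row_mx _ _ = row_mx (lsubmx v) (L (lsubmx v)) +
    row_mx 0 (rsubmx v - L (lsubmx v))); last first.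
    by rewrite add_row_mx addr0 addrC subrK.
  by apply: memv_add; [apply/physicalP|apply/referenceP]; eexists.
apply/eqP; rewrite -subv0; apply/subvP => v /memv_capP[].
move=> /physicalP[x ->] /referenceP[t /eq_row_mx[-> _]].
by rewrite linear0 row_mx0 mem0v.
Qed.

(* rho and rho^* *)
Definition proj_rho (L : {linear 'rV[R]_d -> 'rV[R]_m}) :=
  daddv_pi (physical L) reference.
Definition proj_rho_star (L : {linear 'rV[R]_d -> 'rV[R]_m}) :=
  daddv_pi reference (physical L).

Definition cubical_window : set 'rV[R]_(d + m) :=
  [set row_mx 0 t | t in [set t : 'rV[R]_m | forall i, 0 <= t 0 i < 1]].

Definition canonical_window (L : {linear 'rV[R]_d -> 'rV[R]_m}) :
    set 'rV[R]_(d + m) :=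
  [set proj_rho_star L v | v in
    [set v : 'rV[R]_(d + m) | forall i, 0 <= v 0 i <= 1]].

End Subspaces.
Arguments reference {R d m}.
Arguments cubical_window {R d m}.

Record cut_project (R : realType) (d m : nat)
    (L : {linear 'rV[R]_d -> 'rV[R]_m}) := CutProject {
  internal : {vspace 'rV[R]_(d + m)};
  window : set 'rV[R]_(d + m);
  translate : torus R (d + m);
  internal_span : (physical L + internal = fullv)%VS;
  internal_disjoint : (physical L :&: internal = 0)%VS;
  window_reference : window `<=` [set` reference];
  proj_pi_lattice_inj :
    {in [pred z : 'rV[R]_(d + m) | z \is a mxOver Num.int] &,
      injective (daddv_pi (physical L) internal)} }.

Section CutProject.
Variables (R : realType) (d m : nat) (L : {linear 'rV[R]_d -> 'rV[R]_m}).
Variable Y : cut_project L.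

Definition proj_pi := daddv_pi (physical L) (internal Y).

Definition strip : set 'rV[R]_(d + m) :=
  [set w + x | w in window Y & x in [set` physical L]].

Definition selected : set 'rV[R]_(d + m) := strip `&` coset (translate Y).

Definition points : set 'rV[R]_(d + m) := [set proj_pi z | z in selected].

Definition boundary (T : topologicalType) (A : set T) : set T :=
  closure A `\` interior A.

Definition regular_cut_project :=
  coset (translate Y) `&` boundary strip = set0.

Definition totally_irrational :=
  dense (\pi_(torus R (d + m)) @` [set` physical L]).

Definition aperiodic := forall x, x \in physical L ->
  [set y + x | y in points] = points -> x = 0.

Definition cubical_cut_project :=
  [/\ regular_cut_project, totally_irrational, aperiodic &
      window Y = cubical_window].

Definition canonical_cut_project :=
  [/\ regular_cut_project, totally_irrational, aperiodic &
      window Y = canonical_window L].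

(* the point y~ over y; the default 0 is never used for y in Y *)
Definition lift_point (y : 'rV[R]_(d + m)) : 'rV[R]_(d + m) :=
  xget 0 [set z | selected z /\ proj_pi z = y].

Definition patch_shape (Omega : set 'rV[R]_(d + m)) :=
  [/\ Omega `<=` [set` physical L], bounded_set Omega, convex_set Omega &
      within [set` physical L] (nbhs (0 : 'rV[R]_(d + m))) Omega].

Definition cps_patch (Omega : set 'rV[R]_(d + m)) (y : 'rV[R]_(d + m))
    (r : R) :=
  [set y' | points y' /\
    [set r *: w | w in Omega] (proj_rho L (lift_point y' - lift_point y))].

Definition patch_equiv Omega (r : R) (y1 y2 : 'rV[R]_(d + m)) :=
  cps_patch Omega y1 r = [set x + y1 - y2 | x in cps_patch Omega y2 r].

(* balls are those of the maximum norm *)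
Definition linearly_repetitive Omega := exists2 C : R, 0 < C &
  forall r, 1 <= r -> forall y, points y ->
  forall c, c \in physical L ->
  exists y', [/\ points y', ball c (C * r / 2) y' & patch_equiv Omega r y' y].

End CutProject.

Section LinearForm.
Variables (R : realType) (d : nat).

(* a linear form, seen as a linear map into R^1 *)
Definition form_map (L : 'rV[R]_d -> R) (x : 'rV[R]_d) : 'rV[R]_1 := (L x)%:M.

Fact form_map_is_linear (L : {scalar 'rV[R]_d}) : linear (form_map L).
Proof.
by move=> a x y; rewrite /form_map linearP/= raddfD /= -scale_scalar_mx.
Qed.

HB.instance Definition _ (L : {scalar 'rV[R]_d}) :=
  GRing.isLinear.Build R 'rV[R]_d 'rV[R]_1 _ (form_map L)
    (form_map_is_linear L).

Definition dist_int (x : R) : R :=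
  inf [set `|x - z%:~R| | z in [set: int]].

Definition badly_approximable (L : 'rV[R]_d -> R) := exists2 C : R, 0 < C &
  forall n : 'rV[int]_d, n != 0 ->
  dist_int (L (map_mx intr n)) >= C / `|map_mx intr n : 'rV[R]_d| ^+ d.

End LinearForm.

(* Main.v *)
(* Let h(x, t) = t - L x.  A point z of Z^k + s is selected when h z lies in an
   interval, whose endpoints are heights of integer vectors, and two selected
   points have equivalent patches of size r iff no translate of an endpoint by
   some h n, with n an integer vector of size at most about r, separates their
   heights.
   If L is badly approximable, these cut points are at distance at least
   c / r^d from each other, so next to each height there is an interval of
   length comparable to 1 / r^d free of cut points; an inhomogeneous
   approximation argument (a packing argument on the circle) finds, within
   distance O(r) of any place, a point whose height is in this interval.
   Conversely, if h v = e is small and positive, the points whose height is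
   within e of the lower end of the window are recognized by their patch of
   size O(|v|).  By repetitivity they occur within O(|v|) of every place.
   Their translates by i v, i < 1 / e, are pairwise distinct, so counting
   integer points in a large box gives 1 / e = O(|v|^d). *)
From HB Require Import structures.
Require Import Defs.
From mathcomp Require Import all_boot all_order all_algebra.
From mathcomp Require Import all_classical all_reals all_analysis.
From mathcomp Require Import zify ring lra.
Import Order.TTheory GRing.Theory Num.Theory.
Import numFieldNormedType.Exports.
Local Open Scope classical_set_scope.
Local Open Scope ring_scope.

Set Implicit Arguments.
Unset Strict Implicit.
Unset Printing Implicit Defensive.

(** * Packing and inhomogeneous approximation on the circle *)

Lemma separated_card (R : realType) (T : finType) (u : T -> R) (dl : R) :
  0 < dl <= 1 ->
  (forall x y, x != y -> forall p : int, dl <= `|u x - u y - p%:~R|) ->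
  dl * #|T|%:R <= 2.
Proof.
move=> /andP[dl0 dl1] sep.
pose fr x : R := u x - (Num.floor (u x))%:~R.
have fr0 x : 0 <= fr x by rewrite subr_ge0 floor_le.
have fr1 x : fr x < 1 by rewrite ltrBlDl -intrD1 floorD1_gt.
have frd x : 0 <= fr x / dl by rewrite divr_ge0// ltW.
(* Pigeonhole: [Q] consecutive arcs of length [dl] starting at 0 cover the circle, and two values in
   one arc are closer than [dl] modulo 1. Hence [#|T| <= Q <= dl^-1 + 1]. *)
pose Q := (Num.truncn dl^-1).+1.
have idxP x : (Num.truncn (fr x / dl) < Q)%N.
  rewrite ltnS le_truncn// -[leRHS]mul1r ler_wpM2r ?invr_ge0 ?ltW//; exact: fr1.
pose idx x := Ordinal (idxP x).
have idxI : injective idx.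
  move=> x y [/eqP exy]; apply/eqP; apply/negPn/negP => nxy.
  have := sep _ _ nxy (Num.floor (u x) - Num.floor (u y)).
  rewrite intrB; set z := (X in `|X|) => dz.
  have zE : z = fr x - fr y by rewrite /z /fr; ring.
  have := truncn_itv (frd x); have := truncn_itv (frd y).
  rewrite (eqP exy); set q := Num.truncn _ => /andP[y1 y2] /andP[x1 x2].
  move: dz; rewrite zE leNgt => /negP; apply.
  have : `|(fr x / dl) - (fr y / dl)| < 1.
    move: y2 x2; rewrite -natr1 => y2 x2.
    by rewrite ltr_norml; apply/andP; split; lra.
  by rewrite -mulrBl normrM (gtr0_norm (_ : 0 < dl^-1)) ?invr_gt0//
    ltr_pdivrMr// mul1r.
have := leq_card _ idxI; rewrite card_ord => TQ.
have : #|T|%:R <= Q%:R :> R by rewrite ler_nat.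
move=> TQR; have Qd : Q%:R <= dl^-1 + 1.
  by rewrite -natr1 lerD2r truncn_le invr_ge0 ltW.
have /(ler_wpM2l (ltW dl0)) := le_trans TQR Qd.
by move=> /le_trans; apply; rewrite mulrDr divff ?gt_eqF// mulr1; lra.
Qed.

Section Covering.
Variables (R : realType) (d : nat) (L : {scalar 'rV[R]_d}).

(** The size allowed for the integer vector and the error both grow linearly in [j], so that sums of
    approximable numbers are approximable with the sum of the indices. *)
Definition approximable (N : nat) (dl : R) (j : nat) (th : R) :=
  exists (n : 'rV[int]_d) (p : int),
    (forall i, `|n 0 i| <= (j * N)%N%:Z) /\
    `|th - L (map_mx intr n) - p%:~R| <= j%:R * dl.

Variables (N : nat) (dl : R).
Local Notation approx := (approximable N dl).

Lemma approximableD i j x y :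
  approx i x -> approx j y -> approx (i + j)%N (x + y).
Proof.
move=> [n [p [nN np]]] [m [q [mN mq]]]; exists (n + m), (p + q); split=> [k|].
  by rewrite mxE (le_trans (ler_normD _ _))// mulnDl PoszD lerD.
rewrite map_mxD linearD intrD natrD mulrDl.
rewrite (_ : _ - _ = (x - L (map_mx intr n) - p%:~R) +
  (y - L (map_mx intr m) - q%:~R)); last by ring.
by rewrite (le_trans (ler_normD _ _))// lerD.
Qed.

Lemma approximable_le i j x : 0 <= dl -> (i <= j)%N -> approx i x -> approx j x.
Proof.
move=> dl0 ij [n [p [nN np]]]; exists n, p; split=> [k|].
  by rewrite (le_trans (nN k))// lez_nat leq_mul2r ij orbT.
by rewrite (le_trans np)// ler_wpM2r// ler_nat.
Qed.

Lemma approximable_small j x : `|x| <= j%:R * dl -> approx j x.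
Proof.
move=> xj; exists 0, 0; split=> [k|]; first by rewrite mxE normr0.
by rewrite map_mx0 linear0 !subr0.
Qed.

(** Every real is a sum of finitely many numbers of absolute value at most [dl]. Each is
    1-approximable by the zero vector, and stability absorbs these summands one at a time. *)
Lemma approximable_stable j : 0 < dl ->
  (forall x, approx j.+1 x -> approx j x) -> forall x, approx j x.
Proof.
move=> dl0 stab.
have main m x : `|x| <= m%:R * dl -> approx j x.
  elim: m x => [|m IH] x xm.
    apply: (@approximable_le 0) => //; first exact: ltW.
    exact: approximable_small.
  have m0 : (0 : R) < m.+1%:R by rewrite ltr0n.
  have xE : x = x * (m%:R / m.+1%:R) + x / m.+1%:R.
    rewrite -mulrDr -{2}(mul1r m.+1%:R^-1) -mulrDl natr1.
    by rewrite divff ?mulr1 ?gt_eqF.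
  have xd : `|x / m.+1%:R| <= dl.
    by rewrite normrM normfV (gtr0_norm m0) ler_pdivrMr// mulrC.
  apply: stab; rewrite xE -addn1; apply: approximableD.
    apply: IH; rewrite mulrCA normrM ger0_norm ?ler0n//.
    exact: ler_wpM2l.
  by apply: approximable_small; rewrite mul1r.
move=> x; apply: (main (Num.bound `|x / dl|)).
have := archi_boundP (normr_ge0 (x / dl)).
by rewrite {1}normrM normfV (gtr0_norm dl0) ltr_pdivrMr//; exact: ltW.
Qed.

End Covering.

(* The numbers th i + L m, with m in the cube of side N, are separated modulo 1:
   for equal i by the lower bound on L, for distinct i by hypothesis. *)
Lemma packing_bound (R : realType) (d : nat) (L : {scalar 'rV[R]_d}) (N : nat)
    (c : R) (M : nat) (th : 'I_M -> R) :
  (0 < N)%N -> 0 < c <= 1 ->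
  (forall n : 'rV[int]_d, n != 0 -> (forall i, `|n 0 i| <= N%:Z) ->
     forall p : int, c / N%:R ^+ d <= `|L (map_mx intr n) - p%:~R|) ->
  (forall i j, i != j -> ~ approximable L N (c / N%:R ^+ d) 1 (th i - th j)) ->
  c * M%:R <= 2.
Proof.
move=> N0 /andP[c0 c1] sep pack.
have N0R : (0 : R) < N%:R ^+ d by rewrite exprn_gt0// ltr0n.
have N1R : (1 : R) <= N%:R ^+ d by rewrite exprn_ege1// ler1n.
pose T := ('I_M * {ffun 'I_d -> 'I_N})%type.
pose vec (f : {ffun 'I_d -> 'I_N}) : 'rV[int]_d := \row_i (f i : nat)%:Z.
pose u (x : T) := th x.1 + L (map_mx intr (vec x.2)).
have vecB f g i : `|(vec f - vec g) 0 i| <= N%:Z.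
  by rewrite !mxE; have := ltn_ord (f i); have := ltn_ord (g i); lia.
have := @separated_card _ _ u (c / N%:R ^+ d).
rewrite card_prod card_ffun !card_ord natrM natrX.
rewrite (mulrC M%:R) mulrA divfK ?gt_eqF//; apply.
  by rewrite divr_gt0//= ler_pdivrMr// mul1r (le_trans c1).
move=> [i f] [j g] /= nfg p; have [ij|nij] := eqVneq i j; last first.
  rewrite leNgt; apply/negP => lt; apply: (pack i j nij).
  exists (vec g - vec f), p; split; first by rewrite mul1n; exact: vecB.
  rewrite mul1r map_mxB linearB; apply: le_trans (ltW lt).
  by rewrite [leRHS](_ : _ = `|th i - th j - (L (map_mx intr (vec g)) -
    L (map_mx intr (vec f))) - p%:~R|)//; congr `|_|; rewrite /u /=; ring.
have nfg' : f != g by apply: contra nfg => /eqP ->; rewrite ij.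
have -> : u (i, f) - u (j, g) = L (map_mx intr (vec f - vec g)).
  by rewrite /u /= ij map_mxB linearB; ring.
apply: sep; last exact: vecB.
apply: contra nfg'; rewrite subr_eq0 => /eqP/rowP fg.
by apply/eqP/ffunP => k; have := fg k; rewrite !mxE => -[] /ord_inj.
Qed.

(* If the set G_j of j-approximable numbers never stabilizes for j <= 2M, pick
   th_i in G_(2i+1) but not in G_(2i): since G_i + G_j is contained in G_(i+j),
   no difference th_i - th_j lies in G_1, contradicting packing_bound.  Once
   G_j is stable it is invariant under small translations, hence is all of R. *)
Lemma approximable_all (R : realType) (d : nat) (L : {scalar 'rV[R]_d})
    (N : nat) (c : R) (M : nat) :
  (0 < N)%N -> 0 < c <= 1 -> 2 < c * M%:R ->
  (forall n : 'rV[int]_d, n != 0 -> (forall i, `|n 0 i| <= N%:Z) ->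
     forall p : int, c / N%:R ^+ d <= `|L (map_mx intr n) - p%:~R|) ->
  forall th, approximable L N (c / N%:R ^+ d) (2 * M) th.
Proof.
move=> N0 c01 cM sep th; apply: contrapT => nth.
have dl0 : 0 < c / N%:R ^+ d :> R.
  by case/andP: c01 => ? _; rewrite divr_gt0// exprn_gt0// ltr0n.
set dl := c / _ in dl0 nth.
have /choice[f fP] (j : nat) : exists x, (j <= 2 * M)%N ->
    approximable L N dl j.+1 x /\ ~ approximable L N dl j x.
  apply: contrapT => /forallNP nx; apply: nth.
  have jM : (j <= 2 * M)%N.
    by apply: contrapT => nj; apply: (nx 0) => /nj.
  apply: (@approximable_le _ _ _ _ _ j); rewrite ?(ltW dl0)//.
  apply: approximable_stable => // x xj; apply: contrapT => nxj.
  by apply: (nx x).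
have := @packing_bound _ _ L N c M (fun i => f (2 * i)%N) N0 c01 sep.
suff pack : forall i j : 'I_M, i != j ->
    ~ approximable L N dl 1 (f (2 * i)%N - f (2 * j)%N).
  by move=> /(_ pack); rewrite leNgt cM.
have appN x : approximable L N dl 1 x -> approximable L N dl 1 (- x).
  move=> [n [p [nN np]]]; exists (- n), (- p); split=> [k|].
    by rewrite mxE normrN.
  rewrite map_mxN (linearN L) mulrNz -normrN.
  by rewrite [X in `|X|](_ : _ = x - L (map_mx intr n) - p%:~R)//; ring.
have main (i j : 'I_M) : (j < i)%N ->
    ~ approximable L N dl 1 (f (2 * i)%N - f (2 * j)%N).
  move=> ji ap; have [|_] := fP (2 * i)%N; first by have := ltn_ord i; lia.
  apply; rewrite -(subrK (f (2 * j)%N) (f (2 * i)%N)).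
  (* Using only even indices leaves the room needed here: [j < i] gives
     [1 + (2 * j).+1 <= 2 * i]. *)
  apply: (@approximable_le _ _ _ _ _ (1 + (2 * j).+1)%N); first exact: ltW.
    lia.
  apply: approximableD => //; apply: (fP (2 * j)%N _).1.
  by have := ltn_ord j; lia.
move=> i j nij; case: (ltngtP i j) => [ij|/main//|/ord_inj ij].
  by move=> /appN; rewrite opprB; exact: main.
by rewrite ij eqxx in nij.
Qed.

(** * Heights, projections and patches in coordinates *)

Lemma int_rowD (R : realType) n (x y : 'rV[R]_n) : x \is a mxOver Num.int ->
  y \is a mxOver Num.int -> x + y \is a mxOver Num.int.
Proof.
by move=> /mxOverP xZ /mxOverP yZ; apply/mxOverP => i j; rewrite mxE rpredD.
Qed.

Lemma int_rowN (R : realType) n (x : 'rV[R]_n) : x \is a mxOver Num.int ->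
  - x \is a mxOver Num.int.
Proof. by move=> /mxOverP xZ; apply/mxOverP => i j; rewrite mxE rpredN. Qed.

Lemma int_rowB (R : realType) n (x y : 'rV[R]_n) : x \is a mxOver Num.int ->
  y \is a mxOver Num.int -> x - y \is a mxOver Num.int.
Proof. by move=> xZ yZ; apply/int_rowD/int_rowN. Qed.

Section Height.
Variables (R : realType) (d : nat) (L : {scalar 'rV[R]_d}).
Local Notation V := 'rV[R]_(d + 1).
Local Notation E := (physical (form_map L)).

Definition height (z : V) : R := rsubmx z 0 0 - L (lsubmx z).

Fact height_is_linear : scalar height.
Proof.
move=> a x y.
have ls : lsubmx (a *: x + y) = a *: lsubmx x + lsubmx y by rewrite linearP.
by rewrite /height ls (linearP L) !mxE /=; ring.
Qed.

HB.instance Definition _ :=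
  GRing.isLinear.Build R V R _ height height_is_linear.

Lemma height_row x t : height (row_mx x t) = t 0 0 - L x.
Proof. by rewrite /height row_mxKl row_mxKr. Qed.

Lemma row_mx_height z : z = row_mx (lsubmx z) (L (lsubmx z) + height z)%:M.
Proof.
rewrite -{1}[z]hsubmxK; congr row_mx; apply/rowP => i.
by rewrite ord1 [RHS]mxE eqxx mulr1n /height addrC subrK.
Qed.

Lemma mem_physical z : (z \in E) = (height z == 0).
Proof.
apply/idP/eqP => [/physicalP[x ->]|z0].
  by rewrite height_row mxE mulr1n subrr.
by apply/physicalP; exists (lsubmx z); rewrite {1}(row_mx_height z) z0 addr0.
Qed.

Definition axis (t : R) : V := row_mx 0 t%:M.

Lemma height_axis t : height (axis t) = t.
Proof. by rewrite height_row linear0 subr0 mxE mulr1n. Qed.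

Lemma subr_axis_height z :
  z - axis (height z) = row_mx (lsubmx z) (form_map L (lsubmx z)).
Proof.
rewrite {1}(row_mx_height z) opp_row_mx add_row_mx subr0 -raddfB /=.
by rewrite addrK.
Qed.

Lemma proj_rhoE z :
  proj_rho (form_map L) z = row_mx (lsubmx z) (form_map L (lsubmx z)).
Proof.
have [_ dis] := physical_reference_compl (form_map L).
rewrite -subr_axis_height -{1}(subrK (axis (height z)) z).
rewrite /proj_rho linearD/= daddv_pi_id//; last first.
  by rewrite mem_physical linearB/= height_axis subrr.
rewrite [X in _ + X](_ : _ = 0) ?addr0//.
have ax : axis (height z) \in reference.
  by apply/referenceP; exists (height z)%:M.
have dis' : (reference :&: E = 0)%VS by rewrite capvC.
have := daddv_pi_add dis (subvP (addvSr E _) _ ax).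
rewrite (daddv_pi_id dis' ax) => H.
by apply: (addIr (axis (height z))); rewrite H add0r.
Qed.

Lemma proj_rho_starE z : proj_rho_star (form_map L) z = axis (height z).
Proof.
have [spn dis] := physical_reference_compl (form_map L).
have zE : z \in (E + reference)%VS by rewrite spn memvf.
have := daddv_pi_add dis zE; rewrite -/(proj_rho _) -/(proj_rho_star _).
rewrite proj_rhoE -subr_axis_height => H.
by apply: (addrI (z - axis (height z))); rewrite H subrK.
Qed.

Variable Y : cut_project (form_map L).

(** Take for [f] the internal component of [axis 1]; its height is 1 because the physical component
    has height 0. Selected points have bounded height, so [proj_pi] moves them by a bounded multiple
    of [f]. *)
Lemma proj_piE : exists2 f : V, height f = 1 &
  forall z, proj_pi Y z = z - height z *: f.
Proof.
have spn := internal_span Y; have dis := internal_disjoint Y.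
have : axis 1 \in (E + internal Y)%VS by rewrite spn memvf.
move=> /memv_addP[x xE [f fI axf]].
have hf : height f = 1.
  move: xE; rewrite mem_physical => /eqP xE.
  by rewrite -(add0r (height f)) -xE -linearD /= -axf height_axis.
exists f => // z; set k := height z.
have kf : k *: f \in internal Y by rewrite memvZ.
rewrite /proj_pi -{1}(subrK (k *: f) z) linearD/=.
rewrite daddv_pi_id//; last first.
  by rewrite mem_physical linearB linearZ/= hf mulr1 subrr.
rewrite [X in _ + X](_ : _ = 0) ?addr0//.
have dis' : (internal Y :&: E = 0)%VS by rewrite capvC.
have := daddv_pi_add dis (subvP (addvSr E _) _ kf).
rewrite (daddv_pi_id dis' kf) => H.
by apply: (addIr (k *: f)); rewrite H add0r.
Qed.

Lemma stripE z : strip Y z <-> window Y (axis (height z)).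
Proof.
split=> [[w wW [x]]|wW].
  rewrite /= mem_physical => /eqP x0 <-.
  have /referenceP[t wt] : w \in reference := window_reference wW.
  rewrite linearD/= x0 addr0 wt height_row linear0 subr0.
  suff -> : axis (t 0 0) = w by [].
  by rewrite wt; congr row_mx; apply/rowP => i; rewrite ord1 mxE mulr1n.
exists (axis (height z)) => //; exists (z - axis (height z)).
  by rewrite /= mem_physical linearB/= height_axis subrr.
by rewrite addrC subrK.
Qed.

Local Notation integral z := (z \is a mxOver Num.int).

Lemma coset_add z n : coset (translate Y) z -> integral n ->
  coset (translate Y) (z + n).
Proof.
rewrite -(reprK (translate Y)) cosetE => -[m mZ <-] nZ.
by exists (m + n); [exact: int_rowD|rewrite addrAC].
Qed.

Lemma coset_sub z1 z2 : coset (translate Y) z1 -> coset (translate Y) z2 ->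
  integral (z1 - z2).
Proof.
rewrite -(reprK (translate Y)) cosetE => -[m mZ <-] [n nZ <-].
by rewrite opprD addrACA subrr addr0; exact: int_rowB.
Qed.

Lemma proj_pi_inj z1 z2 : integral (z1 - z2) -> proj_pi Y z1 = proj_pi Y z2 ->
  z1 = z2.
Proof.
move=> zZ z12; apply/eqP; rewrite -subr_eq0; apply/eqP.
apply: (proj_pi_lattice_inj (c := Y)); rewrite ?inE//.
  exact/mxOver0/rpred0.
by rewrite linear0 linearB/= -!/(proj_pi Y) z12 subrr.
Qed.

Lemma lift_pointK z : selected Y z -> lift_point Y (proj_pi Y z) = z.
Proof.
move=> sz; rewrite /lift_point; case: xgetP => [y _ [[_ cy] yz]|].
  by apply: proj_pi_inj => //; apply: coset_sub => //; case: sz.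
by move=> /(_ z) /=; elim.
Qed.

(** A patch at [z] amounts to a set of integral displacements [n] with [z + n] selected. By
    linearity the same [n] gives corresponding points in both patches, and injectivity of the
    projection on the lattice recovers [n] from a point. *)
Lemma patch_equivE Omega r z1 z2 : selected Y z1 -> selected Y z2 ->
  patch_equiv Y Omega r (proj_pi Y z1) (proj_pi Y z2) <->
  (forall n, integral n ->
    [set r *: w | w in Omega] (proj_rho (form_map L) n) ->
    (selected Y (z1 + n) <-> selected Y (z2 + n))).
Proof.
move=> s1 s2; have [_ c1] := s1; have [_ c2] := s2.
have patchP z x : selected Y z -> cps_patch Y Omega (proj_pi Y z) r x <->
    exists n, [/\ integral n, selected Y (z + n), x = proj_pi Y (z + n) &
      [set r *: w | w in Omega] (proj_rho (form_map L) n)].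
  move=> sz; split=> [[[y sy <-]]|[n [nZ szn -> Dn]]].
    rewrite !lift_pointK// => Dn.
    exists (y - z); rewrite (addrC z) subrK; split=> //.
    by apply: coset_sub; [case: sy|case: sz].
  split; first by exists (z + n).
  by rewrite !lift_pointK// addrAC subrr add0r.
have piB n : proj_pi Y (z1 + n) =
    proj_pi Y (z2 + n) + proj_pi Y z1 - proj_pi Y z2.
  by rewrite -linearD -linearB/= -(addrA z2) (addrC z2) addrK addrC.
split=> [P12 n nZ Dn|H].
  split=> [sn|sn].
    have : cps_patch Y Omega (proj_pi Y z1) r (proj_pi Y (z1 + n)).
      by apply/patchP => //; exists n.
    rewrite P12 => -[x /patchP[//|m [mZ sm ->]]] _; rewrite -piB => eqp.
    suff <- : m = n by [].
    apply: (addrI z1); apply: proj_pi_inj => //.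
    by rewrite opprD addrACA subrr add0r; exact: int_rowB.
  have : cps_patch Y Omega (proj_pi Y z1) r (proj_pi Y (z1 + n)).
    rewrite P12; exists (proj_pi Y (z2 + n)); last by rewrite -piB.
    by apply/patchP => //; exists n.
  move=> /patchP[//|m [mZ sm eqp _]].
  suff -> : n = m by [].
  apply: (addrI z1); apply: proj_pi_inj => //.
  by rewrite opprD addrACA subrr add0r; exact: int_rowB.
apply/seteqP; split=> x /=.
  move=> /patchP[//|n [nZ sn -> Dn]]; exists (proj_pi Y (z2 + n)).
    by apply/patchP => //; exists n; split=> //; apply/H.
  by rewrite -piB.
move=> [_ /patchP[//|n [nZ sn -> Dn]]]; rewrite -piB => <-.
by apply/patchP => //; exists n; split=> //; apply/H.
Qed.

End Height.

(** * Maximum norm of rows and bounds for linear forms *)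

Section RowNorm.
Variables (R : realType) (n : nat).
Implicit Types x : 'rV[R]_n.

Lemma row_norm_ge x i : `|x 0 i| <= `|x|.
Proof.
have -> : `|x| = mx_norm x by [].
by rewrite mx_normrE; exact: (le_bigmax _ (fun ij => `|x ij.1 ij.2|) (0, i)).
Qed.

Lemma row_norm_le x e : 0 <= e -> (forall i, `|x 0 i| <= e) -> `|x| <= e.
Proof.
move=> e0 xe; have -> : `|x| = mx_norm x by [].
by rewrite mx_normrE; apply: bigmax_le => // -[i j] _; rewrite ord1.
Qed.

Lemma row_norm_lt x e : 0 < e -> (forall i, `|x 0 i| < e) -> `|x| < e.
Proof.
move=> e0 xe; have -> : `|x| = mx_norm x by [].
by rewrite mx_normrE; apply: bigmax_lt => // -[i j] _; rewrite ord1.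
Qed.

Lemma row_ballE x y e : ball x e y = (`|x - y| < e) :> Prop.
Proof. by rewrite mx_norm_ball. Qed.

End RowNorm.

Lemma row_mx_norm_lt (R : realType) m n (x : 'rV[R]_m) (y : 'rV[R]_n) e :
  `|x| < e -> `|y| < e -> `|row_mx x y| < e.
Proof.
move=> xe ye; apply: row_norm_lt => [|i]; first exact: le_lt_trans xe.
rewrite mxE; case: fintype.split => j.
  exact: le_lt_trans (row_norm_ge _ _) _.
exact: le_lt_trans (row_norm_ge _ _) _.
Qed.

Lemma norm_lsubmx (R : realType) m n (x : 'rV[R]_(m + n)) : `|lsubmx x| <= `|x|.
Proof. by apply: row_norm_le => // i; rewrite mxE row_norm_ge. Qed.

Lemma linear_formE (R : realType) d (L : {scalar 'rV[R]_d}) x :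
  L x = \sum_i x 0 i * L (delta_mx 0 i).
Proof.
rewrite {1}[x]row_sum_delta raddf_sum; apply: eq_bigr => i _.
exact: (scalarZ L).
Qed.

Lemma linear_form_bound (R : realType) d (L : {scalar 'rV[R]_d}) :
  exists2 K, 0 <= K & forall x, `|L x| <= K * `|x|.
Proof.
exists (\sum_i `|L (delta_mx 0 i)|) => [|x]; first exact: sumr_ge0.
rewrite linear_formE mulr_suml (le_trans (ler_norm_sum _ _ _))//.
by apply: ler_sum => i _; rewrite normrM mulrC ler_wpM2l// row_norm_ge.
Qed.

(** * Windows as height intervals; regularity and aperiodicity *)

Section Window.
Variables (R : realType) (d : nat) (L : {scalar 'rV[R]_d}).
Local Notation V := 'rV[R]_(d + 1).
Local Notation h := (height L).
Local Notation integral z := (z \is a mxOver Num.int).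

(* Up to endpoints, W is the interval ]h va, h vb[ of the vertical axis. *)
Definition window_between (W : set V) (va vb : V) :=
  [/\ integral va, integral vb, h va + 1 <= h vb,
      forall t, h va < t < h vb -> W (axis d t) &
      forall t, W (axis d t) -> h va <= t <= h vb].

Lemma axis_inj : injective (@axis R d).
Proof.
by move=> t u /eq_row_mx[_ /rowP/(_ 0)]; rewrite !mxE.
Qed.

Lemma cubical_window_between : window_between cubical_window 0 (axis d 1).
Proof.
split; rewrite ?linear0 ?height_axis ?add0r //.
- exact/mxOver0/rpred0.
- apply/mxOverP => i j; rewrite mxE.
  by case: fintype.split => k; rewrite !mxE ?rpred0.
- move=> t /andP[t0 t1]; exists t%:M => // i.
  by rewrite ord1 mxE eqxx mulr1n (ltW t0).
- move=> t [u u01 /eq_row_mx[_ /rowP/(_ 0)]].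
  by have /andP[] := u01 0; rewrite [_%:M _ _]mxE eqxx mulr1n => ? ? <-; lra.
Qed.

Lemma canonical_windowE t : canonical_window (form_map L) (axis d t) <->
  exists2 v : V, (forall i, 0 <= v 0 i <= 1) & h v = t.
Proof.
split=> -[v v01 vt]; exists v => //.
  by apply: axis_inj; rewrite -vt proj_rho_starE.
by rewrite -vt proj_rho_starE.
Qed.

(** The height is extremal on the cube at vertices, chosen coordinatewise by the sign of [L (e i)];
    vertices are integral. The segment joining them fills the interval, whose length is 1 plus the
    sum of the [|L (e i)|]. *)
Lemma canonical_window_between :
  exists va vb, window_between (canonical_window (form_map L)) va vb.
Proof.
pose e i : 'rV[R]_d := delta_mx 0 i.
pose va : V := row_mx (\row_i (0 < L (e i))%R%:R) 0.
pose vb : V := row_mx (\row_i (L (e i) < 0)%R%:R) 1%:M.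
have b01 (b : bool) : 0 <= (b%:R : R) <= 1 by case: b; rewrite ?lexx ?ler01.
have va01 i : 0 <= va 0 i <= 1.
  by rewrite mxE; case: fintype.split => k; rewrite mxE// ?lexx ler01.
have vb01 i : 0 <= vb 0 i <= 1.
  by rewrite mxE; case: fintype.split => k; rewrite mxE.
have hva : h va = - \sum_i (0 < L (e i))%R%:R * L (e i).
  rewrite height_row mxE sub0r linear_formE; congr (- _).
  by apply: eq_bigr => i _; rewrite mxE.
have hvb : h vb = 1 - \sum_i (L (e i) < 0)%R%:R * L (e i).
  rewrite height_row mxE eqxx mulr1n linear_formE; congr (_ - _).
  by apply: eq_bigr => i _; rewrite mxE.
have hv01 (v : V) : (forall i, 0 <= v 0 i <= 1) -> h va <= h v <= h vb.
  move=> v01; rewrite hva hvb /height linear_formE mxE.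
  have /andP[r0 r1] := v01 (rshift d 0).
  apply/andP; split.
    rewrite -[leLHS]add0r lerD// lerN2; apply: ler_sum => i _; rewrite mxE.
    have /andP[l0 l1] := v01 (lshift 1 i); rewrite -/(e i).
    have [Lp|Ln] := ltP 0 (L (e i)); first by rewrite ler_wpM2r// ltW.
    by rewrite mul0r mulr_ge0_le0.
  rewrite lerD// lerN2; apply: ler_sum => i _; rewrite mxE.
  have /andP[l0 l1] := v01 (lshift 1 i); rewrite -/(e i).
  have [Ln|Lp] := ltP (L (e i)) 0; first by rewrite ler_wnM2r// ltW.
  by rewrite mul0r mulr_ge0.
have bint (b : bool) : (b%:R : R) \in Num.int by rewrite intr_nat.
exists va, vb; split.
- apply/mxOverP => i j; rewrite mxE.
  by case: fintype.split => k; rewrite mxE ?rpred0.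
- by apply/mxOverP => i j; rewrite mxE; case: fintype.split => k; rewrite mxE.
- rewrite hva hvb addrC lerD2l lerN2; apply: ler_sum => i _.
  by have [] := ltgtP (L (e i)) 0; rewrite ?mul1r ?mul0r//; lra.
- move=> t /andP[at_ tb]; apply/canonical_windowE.
  have ab : 0 < h vb - h va by rewrite subr_gt0 (lt_trans at_).
  pose la := (t - h va) / (h vb - h va).
  have la0 : 0 <= la by rewrite divr_ge0 ?ltW// subr_gt0.
  have la1 : la <= 1 by rewrite ler_pdivrMr// mul1r lerD2r ltW.
  have laE : la * (h vb - h va) = t - h va by rewrite divfK ?gt_eqF.
  clearbody la.
  have cvx (x y : V) i :
      (x + la *: (y - x)) 0 i = (1 - la) * x 0 i + la * y 0 i.
    by rewrite !mxE; ring.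
  exists (va + la *: (vb - va)) => [i|].
    rewrite cvx; have /andP[x0 x1] := va01 i; have /andP[y0 y1] := vb01 i.
    have la1' : 0 <= 1 - la by lra.
    rewrite addr_ge0 ?mulr_ge0//=.
    rewrite [leRHS](_ : _ = (1 - la) * 1 + la * 1) ?lerD ?ler_wpM2l//.
    by ring.
  have -> : h (va + la *: (vb - va)) = h va + la * (h vb - h va).
    by rewrite linearD/= scalarZ linearB.
  by rewrite laE addrC subrK.
- by move=> t /canonical_windowE[v v01 <-]; exact: hv01.
Qed.

Variable Y : cut_project (form_map L).

(** The sign [(-1) ^+ s] points into the window: [s = false] serves the lower endpoint, [s = true]
    the upper one. Every neighborhood of [z] contains small vertical shifts of [z] both ways, one
    inside the strip and one outside. *)
Lemma strip_boundary (s : bool) z :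
  (forall e, 0 < e < 1 -> window Y (axis d (h z + (-1) ^+ s * e))) ->
  (forall e, 0 < e -> ~ window Y (axis d (h z - (-1) ^+ s * e))) ->
  boundary (strip Y) z.
Proof.
move=> inW outW.
have near (u : R) (B : set V) : `|u| = 1 -> nbhs z B ->
    exists2 e, 0 < e < 1 & B (z + axis d (u * e)).
  move=> u1 /nbhs_ballP[e /= e0 zB]; pose f := Num.min (e / 2) (1 / 2).
  have f0 : 0 < f by rewrite lt_min !divr_gt0.
  exists f; first by rewrite f0 gt_min; apply/orP; right; lra.
  apply: zB; rewrite row_ballE opprD addrA subrr add0r normrN.
  have fe : f < e by rewrite gt_min; apply/orP; left; lra.
  apply: row_mx_norm_lt; first by rewrite normr0.
  apply: row_norm_lt => // i; rewrite ord1 mxE eqxx mulr1n normrM u1 mul1r.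
  by rewrite gtr0_norm.
have s1 : `|(-1) ^+ s| = 1 :> R by rewrite normrX normrN1 expr1n.
split.
  move=> B /(near ((-1) ^+ s) _ s1)[e e01 Be].
  exists (z + axis d ((-1) ^+ s * e)).
  by split=> //; apply/stripE; rewrite linearD/= height_axis; exact: inW.
rewrite /interior => /(near (- (-1) ^+ s) _)[|e /andP[e0 _] /stripE].
  by rewrite normrN.
by rewrite linearD/= height_axis mulNr; exact: outW.
Qed.

Lemma regular_height va vb z : regular_cut_project Y ->
  window_between (window Y) va vb -> coset (translate Y) z ->
  h z != h va /\ h z != h vb.
Proof.
move=> reg [_ _ ab inW outW] cz.
have nb : ~ boundary (strip Y) z by move=> bz; rewrite -[False]/(set0 z) -reg.
split; apply/eqP => hz; apply: nb.
  apply: (@strip_boundary false) => e; rewrite expr0 mul1r hz.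
    by move=> /andP[e0 e1]; apply: inW; apply/andP; split; lra.
  by move=> e0 /outW /andP[]; lra.
apply: (@strip_boundary true) => e; rewrite expr1 mulN1r hz.
  by move=> /andP[e0 e1]; apply: inW; apply/andP; split; lra.
by move=> e0 /outW /andP[]; lra.
Qed.

Lemma selected_height va vb z : regular_cut_project Y ->
  window_between (window Y) va vb -> coset (translate Y) z ->
  selected Y z <-> h va < h z < h vb.
Proof.
move=> reg wab cz; have [za zb] := regular_height reg wab cz.
have [_ _ _ inW outW] := wab; split=> [[/stripE /outW]|hz].
  by rewrite !lt_def => /andP[-> ->]; rewrite za eq_sym zb.
by split=> //; apply/stripE/inW.
Qed.

Lemma selected_height_norm va vb z : regular_cut_project Y ->
  window_between (window Y) va vb -> selected Y z ->
  `|h z| <= `|h va| + `|h vb|.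
Proof.
move=> reg wab sz; have [_ cz] := sz.
have /andP[az zb] := (selected_height reg wab cz).1 sz.
rewrite ler_norml; apply/andP; split.
  rewrite (le_trans _ (ltW az))// lerNl (le_trans (ler_norm _))//.
  by rewrite normrN lerDl.
by rewrite (le_trans (ltW zb))// (le_trans (ler_norm _))// lerDr.
Qed.

(** Such an [n] lies in [E]; translation by it preserves selection and commutes with [proj_pi], so
    it is a period of [points Y]. *)
Lemma aperiodic_height va vb (n : V) : aperiodic Y -> regular_cut_project Y ->
  window_between (window Y) va vb -> integral n -> h n = 0 -> n = 0.
Proof.
move=> aper reg wab nZ n0; apply: aper; first by rewrite mem_physical n0.
have [f _ piE] := proj_piE Y.
have piD m z : h m = 0 -> proj_pi Y (z + m) = proj_pi Y z + m.
  by move=> m0; rewrite !piE linearD/= m0 addr0 addrAC.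
have sel m z : integral m -> h m = 0 -> selected Y z -> selected Y (z + m).
  move=> mZ m0 [sz cz]; split; last exact: coset_add.
  by apply/stripE; rewrite linearD/= m0 addr0; apply/stripE.
apply/seteqP; split=> [_ [_ [z sz <-] <-]|_ [z sz <-]].
  by exists (z + n); rewrite ?piD//; exact: sel.
have nNZ : integral (- n) by exact: int_rowN.
have nN0 : h (- n) = 0 by rewrite raddfN/= n0 oppr0.
exists (proj_pi Y (z - n)); last by rewrite -piD// subrK.
by exists (z - n) => //; exact: sel.
Qed.

End Window.

(** * Heights of lattice points for a badly approximable form *)

Lemma map_mx_intr_eq0 (R : realType) m n (A : 'M[int]_(m, n)) :
  (map_mx intr A == 0 :> 'M[R]_(m, n)) = (A == 0).
Proof.
apply/eqP/eqP => [/matrixP A0|->]; last by rewrite map_mx0.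
apply/matrixP => i j; have := A0 i j.
by rewrite !mxE => /eqP; rewrite intr_eq0 => /eqP.
Qed.

Section Lattice.
Variables (R : realType) (d : nat) (L : {scalar 'rV[R]_d}).
Local Notation V := 'rV[R]_(d + 1).
Local Notation h := (height L).
Local Notation integral z := (z \is a mxOver Num.int).

Definition lattice_point (n : 'rV[int]_d) (p : int) : V :=
  row_mx (map_mx intr n) (p%:~R)%:M.

Lemma lattice_point_integral n p : integral (lattice_point n p).
Proof.
apply/mxOverP => i j; rewrite mxE; case: fintype.split => k; rewrite !mxE//.
by rewrite rpredMn ?intr_int.
Qed.

Lemma integral_lattice_point (z : V) : integral z ->
  exists n p, z = lattice_point n p.
Proof.
move=> /mxOverP zZ; exists (\row_i Num.floor (z 0 (lshift 1 i))).
exists (Num.floor (z 0 (rshift d 0))); rewrite -[LHS]hsubmxK; congr row_mx.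
  by apply/rowP => i; rewrite !mxE floorK.
by apply/rowP => i; rewrite ord1 !mxE eqxx mulr1n floorK.
Qed.

Lemma height_lattice_point n p :
  h (lattice_point n p) = p%:~R - L (map_mx intr n).
Proof. by rewrite height_row mxE eqxx mulr1n. Qed.

Lemma badly_approximable_int (c : R) n p (Q : R) :
  (forall n : 'rV[int]_d, n != 0 ->
     dist_int (L (map_mx intr n)) >= c / `|map_mx intr n : 'rV[R]_d| ^+ d) ->
  0 <= c -> n != 0 -> `|map_mx intr n : 'rV[R]_d| <= Q ->
  c / Q ^+ d <= `|L (map_mx intr n) - p%:~R|.
Proof.
move=> ba c0 n0 nQ; apply: (@le_trans _ _ (dist_int (L (map_mx intr n)))).
  apply: le_trans (ba _ n0); rewrite ler_wpM2l// lef_pV2 ?posrE; last 2 first.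
  - apply: exprn_gt0; apply: lt_le_trans nQ; rewrite normr_gt0.
    by rewrite map_mx_intr_eq0.
  - rewrite exprn_gt0// normr_gt0.
    by rewrite map_mx_intr_eq0.
  by rewrite lerXn2r ?nnegrE// (le_trans _ nQ).
by apply: ge_inf; [exists 0 => _ [k _ <-]|exists p].
Qed.

(** If the horizontal part of [z] is nonzero, this is bad approximability; otherwise [h z] is a
    nonzero integer and [c <= 1 <= Q] suffices. *)
Lemma height_gap (c : R) (z : V) (Q : R) :
  (forall n : 'rV[int]_d, n != 0 ->
     dist_int (L (map_mx intr n)) >= c / `|map_mx intr n : 'rV[R]_d| ^+ d) ->
  0 <= c <= 1 -> integral z -> h z != 0 -> 1 <= Q -> `|lsubmx z| <= Q ->
  c / Q ^+ d <= `|h z|.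
Proof.
move=> ba /andP[c0 c1] /integral_lattice_point[n [p ->]].
rewrite height_lattice_point row_mxKl => hz Q1 nQ.
have [n0|n0] := eqVneq n 0; last first.
  by rewrite distrC; exact: badly_approximable_int.
move: hz; rewrite n0 map_mx0 linear0 subr0 intr_eq0 => p0.
rewrite (@le_trans _ _ 1)//.
  rewrite ler_pdivrMr ?exprn_gt0 ?(lt_le_trans ltr01)// mul1r.
  by rewrite (le_trans c1)// exprn_ege1.
by rewrite -intr_norm (_ : 1 = 1%:~R)// ler_int; lia.
Qed.

Variable Y : cut_project (form_map L).

Lemma coset_dense (c : R) : (0 < d)%N ->
  (forall n : 'rV[int]_d, n != 0 ->
     dist_int (L (map_mx intr n)) >= c / `|map_mx intr n : 'rV[R]_d| ^+ d) ->
  0 < c <= 1 ->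
  exists2 K : R, 0 < K & forall Q, 1 <= Q -> forall (x : 'rV[R]_d) tau,
    exists z, [/\ coset (translate Y) z, `|lsubmx z - x| <= K * Q &
      `|h z - tau| < c / Q ^+ d].
Proof.
move=> d0 ba c01; have /andP[c0 c1] := c01.
(* [approximable_all] asks for [2 < c * M]. This [M] depends on [c] only, which keeps [K]
   independent of [Q]. *)
pose M := (Num.truncn (2 / c)).+1.
have cM : 2 < c * M%:R by rewrite mulrC -ltr_pdivrMr// truncnS_gt.
pose m := (2 * M)%N; have m1 : 1 <= m%:R :> R by rewrite ler1n.
exists (1 + m%:R * (m%:R + 1)) => [|Q Q1 x tau].
  by rewrite addr_gt0// mulr_gt0 ?addr_gt0// (lt_le_trans ltr01).
have Q0 : 0 < Q by exact: lt_le_trans Q1.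
have mQ0 : 0 <= m%:R * Q by rewrite mulr_ge0// ltW.
(* The error [m * (c / N ^ d)] must stay below [c / Q ^ d]. As [d > 0], one has
   [m * Q ^ d <= (m * Q) ^ d < N ^ d]. *)
pose N := (Num.truncn (m%:R * Q)).+1.
have N0 : 0 < N%:R :> R by rewrite ltr0n.
have mQN : m%:R * Q < N%:R by exact: truncnS_gt.
have NmQ : N%:R <= m%:R * Q + 1 by rewrite -natr1 lerD2r truncn_le.
have sep (n : 'rV[int]_d) : n != 0 -> (forall i, `|n 0 i| <= N%:Z) ->
    forall p : int, c / N%:R ^+ d <= `|L (map_mx intr n) - p%:~R|.
  move=> n0 nN p; apply: badly_approximable_int => //; first exact: ltW.
  apply: row_norm_le => [|i]; first exact: ltW.
  by rewrite mxE -intr_norm (_ : N%:R = N%:Z%:~R)// ler_int.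
pose s := repr (translate Y).
(* [n0] brings the point near [x], up to 1 in each coordinate; [n], of size at most [m * N], then
   corrects the height. *)
pose n0 : 'rV[int]_d := \row_i Num.floor ((x - lsubmx s) 0 i).
have [n [p [nN np]]] := approximable_all (ltn0Sn _ : (0 < N)%N) c01 cM sep
  (h s - L (map_mx intr n0) - tau).
exists (s + lattice_point (n0 + n) (- p)); split.
- by apply: coset_add; [rewrite /coset/= reprK|exact: lattice_point_integral].
- apply: row_norm_le => [|i].
    by rewrite mulr_ge0 ?addr_ge0 ?mulr_ge0 ?addr_ge0// ltW.
  have -> : lsubmx (s + lattice_point (n0 + n) (- p)) =
      lsubmx s + map_mx intr (n0 + n) by rewrite linearD/= row_mxKl.
  rewrite map_mxD !mxE; set u := s 0 _.
  set a := x 0 i - u.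
  rewrite (_ : _ - _ = - (a - (Num.floor a)%:~R) + (n 0 i)%:~R); last first.
    by rewrite /a; ring.
  rewrite (le_trans (ler_normD _ _))// normrN.
  have fa1 : `|a - (Num.floor a)%:~R| <= 1.
    rewrite ger0_norm ?subr_ge0 ?floor_le// lerBlDl -intrD1 ltW//.
    exact: floorD1_gt.
  have nN' : `|(n 0 i)%:~R| <= m%:R * N%:R :> R.
    rewrite -intr_norm -natrM (_ : (_ * _)%N%:R = (m * N)%N%:Z%:~R)//.
    by rewrite ler_int.
  rewrite (le_trans (lerD fa1 nN'))// mulrDl mul1r lerD// -mulrA.
  rewrite ler_wpM2l// (le_trans NmQ)// mulrDl mul1r lerD2l//.
- rewrite linearD/= height_lattice_point map_mxD (linearD L) mulrNz.
  rewrite (_ : _ - _ = h s - L (map_mx intr n0) - tau -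
    L (map_mx intr n) - p%:~R).
    apply: le_lt_trans np _; rewrite mulrCA ltr_pM2l//.
    rewrite ltr_pdivrMr ?exprn_gt0// mulrC ltr_pdivlMr ?exprn_gt0//.
    apply: (@le_lt_trans _ _ ((m%:R * Q) ^+ d)).
      by rewrite exprMn ler_wpM2r ?exprn_ge0 ?(ltW Q0)// ler_eXnr.
    by rewrite ltrXn2r// -?lt0n// ?nnegrE ltW.
  by ring.
Qed.

End Lattice.

(** * From bad approximability to linear repetitivity *)

Section BadlyToRepetitive.
Variables (R : realType) (d : nat) (L : {scalar 'rV[R]_d}).
Variable Y : cut_project (form_map L).
Variables (va vb : 'rV[R]_(d + 1)) (Omega : set 'rV[R]_(d + 1)).
Hypotheses (d_gt0 : (0 < d)%N) (reg : regular_cut_project Y).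
Hypothesis wab : window_between L (window Y) va vb.
Hypotheses (Omega_bounded : bounded_set Omega) (Omega0 : Omega 0).
Local Notation V := 'rV[R]_(d + 1).
Local Notation h := (height L).
Local Notation integral z := (z \is a mxOver Num.int).
Local Notation inside r n :=
  ([set r *: w | w in Omega] (proj_rho (form_map L) n)).

Let vaZ : integral va. Proof. by case: wab. Qed.
Let vbZ : integral vb. Proof. by case: wab. Qed.

Lemma inside_bounded : exists2 B : R, 0 < B &
  forall r n, 0 <= r -> inside r n -> `|lsubmx n| <= B * r.
Proof.
have [M [_ MB]] := Omega_bounded.
exists (`|M| + 1) => [|r n r0 [w Ow]]; first by rewrite ltr_pwDr.
rewrite proj_rhoE => /(congr1 lsubmx); rewrite linearZ/= row_mxKl => <-.
rewrite normrZ ger0_norm// mulrC ler_wpM2r// (le_trans (norm_lsubmx _))//.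
by apply: MB => //; rewrite (le_lt_trans (ler_norm _))// ltrDl.
Qed.

(* The values of t at which membership of some t + h n in the window changes,
   n ranging over the lattice vectors seen by a patch of size r. *)
Definition cut_point r x :=
  exists n e, [/\ integral n, inside r n, e = va \/ e = vb & x = h e - h n].

(** Selection of [z + n] is decided by the side of the cut points [h va - h n] and [h vb - h n] on
    which [h z] lies. Regularity keeps heights of the coset off the endpoints, which supplies
    [x != t] and lets strict inequalities be negated. *)
Lemma selected_equiv r tau t z (z1 : V) dl :
  coset (translate Y) z -> coset (translate Y) z1 -> h z = t ->
  (forall x u, cut_point r x -> x != t -> `|u - tau| < dl ->
     (x < t) = (x < u)) ->
  `|h z1 - tau| < dl ->
  forall n, integral n -> inside r n ->
  selected Y (z1 + n) <-> selected Y (z + n).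
Proof.
move=> cz cz1 <- same z1tau n nZ Dn.
have czn := coset_add cz nZ; have cz1n := coset_add cz1 nZ.
rewrite !(selected_height reg wab)//.
have cut e : e = va \/ e = vb -> cut_point r (h e - h n) by exists n, e.
have [] := regular_height reg wab czn; have [] := regular_height reg wab cz1n.
rewrite !linearD/= => a1 b1 a b.
have flip e : e = va \/ e = vb -> h z + h n != h e ->
    (h e < h z + h n) = (h e < h z1 + h n).
  move=> eab ne; rewrite -[LHS]ltrBlDr -[RHS]ltrBlDr.
  apply: same => //; first exact: cut.
  by rewrite subr_eq eq_sym.
have ltb u : u != h vb -> (u < h vb) = ~~ (h vb < u).
  by move=> ne; rewrite lt_neqAle ne leNgt.
by rewrite !ltb// (flip va)//; [rewrite (flip vb)//; right|left].
Qed.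

(* Cut points on both sides of t, each within dl of it, would be too close to
   one another, so tau can be the midpoint of a free interval of length dl. *)
Lemma free_side r t dl : 0 < dl ->
  (forall x y, cut_point r x -> cut_point r y -> x < y -> 2 * dl <= y - x) ->
  exists tau, forall x u, cut_point r x -> x != t ->
    `|u - tau| < dl / 2 -> (x < t) = (x < u).
Proof.
move=> dl0 gap.
have [[p [cp /andP[pt tp]]]|nleft] :=
    pselect (exists p, cut_point r p /\ t - dl < p < t).
  exists (t + dl / 2) => x u cx xt; rewrite ltr_norml => /andP[u1 u2].
  case: ltgtP xt => // tx _; first by apply/esym; lra.
  apply/esym/negbTE; rewrite -leNgt.
  have := gap _ _ cp cx (lt_trans tp tx); lra.
exists (t - dl / 2) => x u cx xt; rewrite ltr_norml => /andP[u1 u2].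
case: ltgtP xt => // tx _; last by apply/esym/negbTE; rewrite -leNgt; lra.
apply/esym; have [//|ux] := ltP x u.
by case: nleft; exists x; split=> //; apply/andP; split=> //; lra.
Qed.

Lemma badly_approximable_linearly_repetitive :
  badly_approximable L -> linearly_repetitive Y Omega.
Proof.
move=> [c' c'0 ba']; pose c := Num.min c' 1.
have c0 : 0 < c by rewrite lt_min c'0 ltr01.
have c1 : c <= 1 by rewrite ge_min lexx orbT.
have ba (n : 'rV[int]_d) : n != 0 ->
    c / `|map_mx intr n : 'rV[R]_d| ^+ d <= dist_int (L (map_mx intr n)).
  move=> n0; apply: le_trans (ba' _ n0).
  rewrite ler_wpM2r ?invr_ge0 ?exprn_ge0//.
  by rewrite ge_min lexx.
have [B B0 inB] := inside_bounded.
have [K K0 dense] := coset_dense Y d_gt0 ba (introT andP (conj c0 c1)).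
have [f hf piE] := proj_piE Y.
have [La La0 LaE] := linear_form_bound L.
(* Two cut points for size [r] differ by the height of an integral vector whose horizontal part is
   at most [2 * B * r + |vb - va|], hence at most [Q1 * r]. *)
pose Q1 := 2 * B + `|vb - va| + 1.
pose H := `|h va| + `|h vb|.
(* The first term is the distance given by [coset_dense] at scale [4 * Q], the second the
   displacement under [proj_pi]; the 1 makes the bound strict. *)
pose X := K * (4 * Q1) + H * `|f| + 1.
have Q10 : 1 <= Q1.
  by rewrite /Q1 lerDr addr_ge0// mulr_ge0// ltW.
have H0 : 0 <= H by rewrite addr_ge0.
have X0 : 0 < X.
  rewrite ltr_wpDl// addr_ge0// mulr_ge0// ?ltW// mulr_gt0//.
  exact: lt_le_trans Q10.
(* The 2 compensates the halving of the diameter, and [1 + La] bounds a vector of [E] by its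
   horizontal part. *)
exists (2 * ((1 + La) * X)); first by rewrite !mulr_gt0// ltr_wpDr.
move=> r r1 _ [z sz <-] x xE; have [_ cz] := sz.
have r0 : 0 <= r by rewrite (le_trans ler01).
pose Q := Q1 * r.
have Q1' : 1 <= Q by rewrite /Q -[leLHS]mulr1 ler_pM.
have Q0 : 0 < Q by rewrite (lt_le_trans ltr01).
pose dl := c / Q ^+ d / 2.
have dl0 : 0 < dl by rewrite !divr_gt0// exprn_gt0.
have hB x1 y1 : h (x1 - y1) = h x1 - h y1 by rewrite linearB.
have gap u w : cut_point r u -> cut_point r w -> u < w -> 2 * dl <= w - u.
  move=> [n1 [e1 [n1Z n1r e1ab ->]]] [n2 [e2 [n2Z n2r e2ab ->]]] lt12.
  have e1Z : integral e1 by case: e1ab => ->.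
  have e2Z : integral e2 by case: e2ab => ->.
  pose v := (e2 - n2) - (e1 - n1).
  have hv : h v = (h e2 - h n2) - (h e1 - h n1) by rewrite /v !hB.
  have hv0 : 0 < h v by rewrite hv subr_gt0.
  rewrite -hv -(gtr0_norm hv0) mulrC divfK//.
  have vZ : integral v by apply: int_rowB; apply: int_rowB.
  apply: (height_gap ba) => //; rewrite ?(ltW c0) ?gt_eqF//.
  have -> : lsubmx v = lsubmx (e2 - e1) + (lsubmx n1 - lsubmx n2).
    rewrite -linearB -linearD/= /v; congr lsubmx.
    by rewrite opprB addrACA [RHS]addrACA (addrC (- n2)).
  have e21 : `|e2 - e1| <= `|vb - va|.
    by case: e1ab => ->; case: e2ab => ->; rewrite ?subrr ?normr0// distrC.
  rewrite (le_trans (ler_normD _ _))//.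
  have := le_trans (norm_lsubmx (e2 - e1)) e21.
  have := ler_normB (lsubmx n1) (lsubmx n2).
  have := inB _ _ r0 n1r; have := inB _ _ r0 n2r.
  rewrite /Q /Q1 !mulrDl mul1r => ? ? ? ?.
  have : `|vb - va| <= `|vb - va| * r by rewrite ler_peMr.
  by lra.
have [tau same] := free_side (h z) dl0 gap.
(* Since [d > 0], the factor 4 in the scale divides the error by at least 4, giving
   [dl / 2 = c / (4 * Q ^ d)]. *)
have [|z1 [cz1 z1x z1tau]] := dense (4 * Q) _ (lsubmx x) tau.
  by rewrite -[leLHS]mulr1 ler_pM// ler1n.
have near : `|h z1 - tau| < dl / 2.
  have -> : dl / 2 = c / (4 * Q ^+ d).
    by rewrite /dl; field; rewrite expf_neq0 ?gt_eqF.
  apply: lt_le_trans z1tau _; rewrite ler_pM2l// lef_pV2 ?posrE.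
  - by rewrite [leRHS]exprMn ler_pM2r ?exprn_gt0// ler_eXnr// ler1n.
  - by rewrite exprn_gt0// mulr_gt0.
  - by rewrite mulr_gt0// exprn_gt0.
have equiv := selected_equiv cz cz1 erefl same near.
have s1 : selected Y z1.
  (* The displacement [n = 0] is seen by every patch, so [z1] is selected because [z] is. *)
  rewrite -[z1]addr0; apply/equiv; rewrite ?addr0//; first exact/mxOver0/rpred0.
  by exists 0 => //; rewrite scaler0 /proj_rho linear0.
exists (proj_pi Y z1); split; [by exists z1| |exact/patch_equivE].
rewrite row_ballE; set w := x - _.
have wE : w \in physical (form_map L) by rewrite rpredB// memv_pi.
have wl : lsubmx w = - (lsubmx z1 - lsubmx x) + h z1 *: lsubmx f.
  have lB (u v : V) : lsubmx (u - v) = lsubmx u - lsubmx v by rewrite linearB.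
  by rewrite /w piE !lB linearZ/= !opprB addrA addrAC.
have hz1 : `|h z1| <= H by exact: selected_height_norm reg wab s1.
have wX : `|lsubmx w| < X * r.
  have -> : X * r = K * (4 * Q) + H * `|f| * r + r by rewrite /X /Q; ring.
  rewrite wl (le_lt_trans (ler_normD _ _))// normrN normrZ.
  rewrite ltr_pwDr ?(lt_le_trans ltr01)// lerD// -mulrA ler_pM//.
  by rewrite (le_trans (norm_lsubmx _))// ler_peMr.
have -> : 2 * ((1 + La) * X) * r / 2 = (1 + La) * (X * r) by field.
rewrite {1}(row_mx_height L w) (eqP (_ : h w == 0)) -?mem_physical// addr0.
have wX0 : 0 < X * r by exact: le_lt_trans wX.
have wXL : `|lsubmx w| < (1 + La) * (X * r).
  by rewrite (lt_le_trans wX)// ler_peMl ?(ltW wX0)// lerDl.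
apply: row_mx_norm_lt => //; apply: row_norm_lt => [|i].
  exact: le_lt_trans wXL.
rewrite ord1 mxE eqxx mulr1n (le_lt_trans (LaE _))//.
by rewrite [ltRHS]mulrDl mul1r addrC ltr_pwDr// ler_wpM2l// ltW.
Qed.
End BadlyToRepetitive.

(* The points m al + i v, for i < q and al in the cube of side A, are pairwise
   distinct and lie in a cube of side A (2U + 2) once A exceeds the size of all
   the i v; the factor A ^ d then cancels. *)
Lemma box_count (d q U : nat) (v : 'rV[int]_d)
    (m : forall A : nat, {ffun 'I_d -> 'I_A} -> 'rV[int]_d) :
  (forall A (al : {ffun 'I_d -> 'I_A}) k,
     `|m A al 0 k - (((2 * U).+1 * al k)%N : int)| <= U%:Z) ->
  (forall A (al be : {ffun 'I_d -> 'I_A}) (i j : 'I_q),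
     m A al + v *+ i = m A be + v *+ j -> i = j) ->
  (q <= (2 * U + 2) ^ d)%N.
Proof.
move=> mU minj; pose W := (q * \max_k absz (v ord0 k))%N.
have vW (i : 'I_q) k : `|(v *+ i) 0 k| <= W%:Z.
  have -> : (v *+ i) 0 k = v 0 k *+ i by elim: (i : nat) => [|n IH];
    rewrite ?mulr0n ?mulrS !mxE ?IH.
  rewrite pmulrn mulrzz -abszE abszM lez_nat absz_nat mulnC.
  by rewrite leq_mul ?(ltnW (ltn_ord i))// (leq_bigmax k).
(* With this [A], the coordinates shifted by [U + W] run from 0 to at most
   [(2 * U + 2) * (2 * W) + 2 * U], below [A * (2 * U + 2)]. *)
pose A := (2 * W).+1.
pose ct (x : 'I_q * {ffun 'I_d -> 'I_A}) k : nat :=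
  absz ((m A x.2 + v *+ x.1) 0 k + (U + W)%N%:Z).
have ctE x k : (ct x k)%:Z = (m A x.2 + v *+ x.1) 0 k + (U + W)%N%:Z.
  rewrite /ct mxE; have := mU A x.2 k; have := vW x.1 k.
  set a := (v *+ _) 0 k; set b := m A x.2 0 k.
  have : 0 <= (((2 * U).+1 * x.2 k)%N : int) by [].
  move: (((2 * U).+1 * x.2 k)%N) => t; lia.
have ctP x k : (ct x k < A * (2 * U + 2))%N.
  have := ctE x k; rewrite mxE; have := mU A x.2 k; have := vW x.1 k.
  set a := (v *+ _) 0 k; set b := m A x.2 0 k.
  have : ((2 * U).+1 * x.2 k <= (2 * U).+1 * (2 * W))%N.
    by rewrite leq_mul2l -ltnS ltn_ord orbT.
  rewrite /A; move: (((2 * U).+1 * x.2 k)%N) => t; nia.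
pose F x : {ffun 'I_d -> 'I_(A * (2 * U + 2))} := [ffun k => Ordinal (ctP x k)].
have Finj : injective F.
  move=> [i al] [j be] /ffunP FE.
  have E : m A al + v *+ i = m A be + v *+ j.
    apply/rowP => k; have := FE k; rewrite !ffunE => -[] /(congr1 Posz).
    by rewrite !ctE => /addIr.
  have ij := minj _ _ _ _ _ E; congr (_, _) => //.
  move: E; rewrite ij => /addIr mE; apply/ffunP => k; apply/val_inj.
  (* A point within [U] of a node of mesh [2 * U + 1] determines that node. *)
  have := mU A al k; have := mU A be k; rewrite mE !PoszM.
  move: (m A be 0 k) => b.
  case: (ltngtP (al k) (be k)) => //=; nia.
have := leq_card _ Finj; rewrite card_prod !card_ffun !card_ord expnMn mulnC.
by rewrite leq_pmul2l// expn_gt0.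
Qed.

(** Here [|g1 - g2| < e] while [(j - i) * e] lies between [e] and [1 - e], so the right-hand side is
    strictly between -1 and 0. *)
Lemma offset_disjoint (R : realType) (a e g1 g2 : R) (q i j : nat) (k : int) :
  0 < e -> q%:R * e <= 1 -> (i < j)%N -> (j < q)%N ->
  a < g1 <= a + e -> a < g2 <= a + e ->
  k%:~R = g1 - g2 + i%:R * e - j%:R * e -> False.
Proof.
move=> e0 qe ij jq /andP[? ?] /andP[? ?] kE.
have ie0 : 0 <= i%:R * e by rewrite mulr_ge0// ltW.
have ije : (i%:R + 1) * e <= j%:R * e.
  by rewrite ler_wpM2r ?(ltW e0)// natr1 ler_nat.
have jqe : (j%:R + 1) * e <= 1.
  by apply: le_trans qe; rewrite ler_wpM2r ?(ltW e0)// natr1 ler_nat.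
rewrite !mulrDl !mul1r in ije jqe.
have : (-1)%:~R < k%:~R :> R by rewrite kE; lra.
have : k%:~R < 0%:~R :> R by rewrite kE; lra.
by rewrite !ltr_int; lia.
Qed.

(** * From linear repetitivity to bad approximability *)

Section RepetitiveToBadly.
Variables (R : realType) (d : nat) (L : {scalar 'rV[R]_d}).
Variable Y : cut_project (form_map L).
Variables (va vb : 'rV[R]_(d + 1)) (Omega : set 'rV[R]_(d + 1)).
Hypotheses (reg : regular_cut_project Y) (aper : aperiodic Y).
Hypothesis wab : window_between L (window Y) va vb.
Variable om : R.
Hypothesis om0 : 0 < om.
Hypothesis Omega_near0 :
  forall w, w \in physical (form_map L) -> `|w| < om -> Omega w.
Local Notation V := 'rV[R]_(d + 1).
Local Notation h := (height L).
Local Notation integral z := (z \is a mxOver Num.int).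

Let ab1 : h va + 1 <= h vb. Proof. by case: wab. Qed.

(** Adding multiples of [v] moves the height in steps of [h v], and the first value above [h va] is
    within one step of it. The window is longer than [h v], so that point is selected. *)
Lemma selected_near_start (v : V) : integral v -> 0 < h v < 1 ->
  exists z, [/\ selected Y z & h va < h z <= h va + h v].
Proof.
move=> vZ /andP[v0 v1]; pose s := repr (translate Y).
pose j := Num.floor ((h va - h s) / h v) + 1.
have jZ : integral (j%:~R *: v).
  by apply/mxOverP => k l; rewrite mxE rpredM ?intr_int//; exact: (mxOverP vZ).
have cs : coset (translate Y) (s + j%:~R *: v).
  by apply: coset_add => //; rewrite /coset/= reprK.
have hz : h (s + j%:~R *: v) = h s + j%:~R * h v by rewrite linearD/= scalarZ.
have az : h va < h (s + j%:~R *: v) <= h va + h v.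
  rewrite hz /j intrD1 mulrDl mul1r; set x := (h va - h s) / h v.
  have xE : x * h v = h va - h s by rewrite divfK ?gt_eqF.
  have : (Num.floor x)%:~R * h v <= x * h v.
    by rewrite ler_wpM2r ?floor_le// ltW.
  have : x * h v < (Num.floor x + 1)%:~R * h v by rewrite ltr_pM2r// floorD1_gt.
  by rewrite xE intrD1 mulrDl mul1r => ? ?; apply/andP; split; lra.
exists (s + j%:~R *: v); split=> //; apply/(selected_height reg wab) => //.
case/andP: az => -> le1 /=; rewrite (le_lt_trans le1)// (lt_le_trans _ ab1)//.
by rewrite ltrD2l.
Qed.

(* Patches occur near every point, so they give points of height in an interval
   of length h v around any place of a grid of mesh 2U + 1; translating them by
   i v with i (h v) < 1 keeps them distinct, even modulo the last coordinate. *)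
Lemma repetitive_height_bound (C : R) (f : V) r (v : V) U :
  (forall z, proj_pi Y z = z - h z *: f) ->
  (forall y, points Y y -> forall c, c \in physical (form_map L) ->
     exists y', [/\ points Y y', ball c (C * r / 2) y' &
       patch_equiv Y Omega r y' y]) ->
  0 < r -> `|proj_rho (form_map L) (- v)| < om * r ->
  integral v -> 0 < h v < 1 ->
  C * r / 2 + (`|h va| + `|h vb|) * `|f| <= U%:R ->
  (Num.truncn (h v)^-1 <= (2 * U + 2) ^ d)%N.
Proof.
move=> piE rep r0 vr vZ v01 XU; have /andP[v0 v1] := v01.
have [n [p vE]] := integral_lattice_point vZ.
have [z [sz /andP[az za]]] := selected_near_start vZ v01.
have nearby (x : 'rV[R]_d) : exists z1,
    [/\ selected Y z1, `|lsubmx z1 - x| <= U%:R & h va < h z1 <= h va + h v].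
  pose c := row_mx x (form_map L x).
  have cE : c \in physical (form_map L) by apply/physicalP; exists x.
  have [_ [[z1 s1 <-] cz1 eq1]] := rep _ (ex_intro2 _ _ z sz erefl) _ cE.
  have c1 : coset (translate Y) z1 by case: s1.
  have /andP[a1 b1] := (selected_height reg wab c1).1 s1.
  exists z1; split=> //.
    move: cz1; rewrite row_ballE piE => cz1.
    have -> : lsubmx z1 - x =
        - lsubmx (c - (z1 - h z1 *: f)) + h z1 *: lsubmx f.
      have lB (u w : V) : lsubmx (u - w) = lsubmx u - lsubmx w.
        by rewrite linearB.
      by rewrite !lB linearZ/= row_mxKl opprB [RHS]addrAC subrK.
    rewrite (le_trans (ler_normD _ _))// normrN normrZ (le_trans _ XU)// lerD//.
      by rewrite (le_trans (norm_lsubmx _))// ltW.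
    by rewrite ler_pM ?norm_lsubmx//; exact: selected_height_norm reg wab s1.
  (* Were [h z1 > h va + h v], then [z1 - v] would be selected. The patch sees [- v], so [z - v]
     would be selected too, although its height is at most [h va]. *)
  rewrite a1 /= -lerBlDr leNgt; apply/negP => az1.
  have nvZ : integral (- v) by exact: int_rowN.
  have Dv : [set r *: w | w in Omega] (proj_rho (form_map L) (- v)).
    exists (r^-1 *: proj_rho (form_map L) (- v)).
      apply: Omega_near0; first by rewrite memvZ ?memv_pi.
      by rewrite normrZ gtr0_norm ?invr_gt0// mulrC ltr_pdivrMr.
    by rewrite scalerA divff ?gt_eqF// scale1r.
  have hB x1 y1 : h (x1 - y1) = h x1 - h y1 by rewrite linearB.
  have : selected Y (z1 - v).
    apply/(selected_height reg wab); first exact: coset_add.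
    by rewrite hB az1 /= ltrBlDr (lt_trans b1)// ltrDl.
  move=> /((patch_equivE _ _ s1 sz).1 eq1 _ nvZ Dv).
  have cz : coset (translate Y) (z - v) by apply: coset_add => //; case: sz.
  move=> /(selected_height reg wab cz); rewrite hB ltrBrDr => /andP[]; lra.
pose s := repr (translate Y).
have pick A (al : {ffun 'I_d -> 'I_A}) : exists mp : 'rV[int]_d * int,
    (forall k, `|mp.1 0 k - (((2 * U).+1 * al k)%N : int)| <= U%:Z) /\
    h va < h s + mp.2%:~R - L (map_mx intr mp.1) <= h va + h v.
  have [z1 [[_ c1] z1x hz1]] :=
    nearby (lsubmx s + \row_k ((2 * U).+1 * al k)%N%:R).
  have cs : coset (translate Y) s by rewrite /coset/= reprK.
  have [m [p1 mE]] := integral_lattice_point (coset_sub c1 cs).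
  have z1E : z1 = lattice_point R m p1 + s by rewrite -mE subrK.
  exists (m, p1); split=> [k|]; last first.
    by move: hz1; rewrite z1E linearD/= height_lattice_point addrC addrA.
  have := le_trans (row_norm_ge _ k) z1x.
  have -> : lsubmx z1 = lsubmx s + map_mx intr m.
    by rewrite z1E linearD/= row_mxKl addrC.
  rewrite !mxE; set u := s 0 _.
  rewrite (_ : _ - _ = (m 0 k - ((2 * U).+1 * al k)%N%:Z)%:~R :> R).
    by rewrite -intr_norm (_ : U%:R = U%:Z%:~R)// ler_int.
  by rewrite intrB /=; ring.
have [g gP] : exists g : forall A, {ffun 'I_d -> 'I_A} -> 'rV[int]_d * int,
    forall A al,
      (forall k, `|(g A al).1 0 k - (((2 * U).+1 * al k)%N : int)| <= U%:Z) /\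
      h va < h s + (g A al).2%:~R - L (map_mx intr (g A al).1) <= h va + h v.
  exists (fun A => projT1 (choice (@pick A))) => A al.
  exact: (projT2 (choice (@pick A))).
apply: (@box_count _ _ _ n (fun A al => (g A al).1)) => [A al k|A al be i j E].
  exact: (gP A al).1.
have [_ /andP[a1 a2]] := gP A al; have [_ /andP[b1 b2]] := gP A be.
move: E a1 a2 b1 b2; move: (g A al) (g A be) => [m1 p1] [m2 p2] /=.
move=> E a1 a2 b1 b2.
have LM (k : nat) : L (map_mx intr (n *+ k)) = k%:R * L (map_mx intr n).
  elim: k => [|k IH]; first by rewrite mulr0n map_mx0 linear0 mul0r.
  by rewrite mulrS map_mxD (linearD L) IH -natr1; ring.
have LE := congr1 (fun x => L (map_mx intr x)) E.
rewrite /= !map_mxD !(linearD L) !LM in LE.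
have hv : h v = p%:~R - L (map_mx intr n) by rewrite vE height_lattice_point.
have qv : (Num.truncn (h v)^-1)%:R * h v <= 1.
  by rewrite -ler_pdivlMr// div1r truncn_le invr_ge0 ltW.
(* When two translates have the same horizontal displacement from [s], their heights differ by an
   integer, the difference of their last coordinates. *)
have shift (i1 j1 : nat) n1 n2 (k1 k2 : int) :
    L (map_mx intr n1) + i1%:R * L (map_mx intr n) =
      L (map_mx intr n2) + j1%:R * L (map_mx intr n) ->
    (k1 - k2 + i1%:Z * p - j1%:Z * p)%:~R =
      (h s + k1%:~R - L (map_mx intr n1)) -
      (h s + k2%:~R - L (map_mx intr n2)) +
      i1%:R * h v - j1%:R * h v.
  move=> n12; rewrite !(intrB, intrD, intrM) -!pmulrn hv.
  rewrite -(addrK (i1%:R * L (map_mx intr n)) (L (map_mx intr n1))) n12.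
  by ring.
apply/ord_inj; case: (ltngtP i j) => // ij; exfalso.
  exact: offset_disjoint v0 qv ij (ltn_ord j) (introT andP (conj a1 a2))
    (introT andP (conj b1 b2)) (shift _ _ _ _ _ _ LE).
exact: offset_disjoint v0 qv ij (ltn_ord i) (introT andP (conj b1 b2))
  (introT andP (conj a1 a2)) (shift _ _ _ _ _ _ (esym LE)).
Qed.

Lemma linearly_repetitive_badly_approximable :
  linearly_repetitive Y Omega -> badly_approximable L.
Proof.
move=> [C C0 rep]; have [f hf piE] := proj_piE Y.
have [La La0 LaE] := linear_form_bound L.
(* For [r = rho * |lsubmx v|] the patch sees [- v]: the entries of its projection are at most
   [(1 + La) * |lsubmx v|], and the 2 gives strictness. The minimum with 1 ensures [1 <= rho], hence
   [1 <= r]. *)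
pose w := Num.min om 1; pose rho := (1 + La) * 2 / w.
have w0 : 0 < w by rewrite lt_min om0 ltr01.
have rho1 : 1 <= rho.
  rewrite ler_pdivlMr// mul1r ge_min; apply/orP; right; lra.
(* Chosen so that [2 * U + 2 <= 2 * (X + 2) <= T * nv] below. *)
pose T := 2 * (C / 2 + (`|h va| + `|h vb|) * `|f| + 2) * rho.
have HF0 : 0 <= (`|h va| + `|h vb|) * `|f| by rewrite mulr_ge0 ?addr_ge0.
have T1 : 1 <= T.
  by rewrite /T -[leLHS]mulr1 ler_pM//; lra.
have T0 : 0 < T by exact: lt_le_trans T1.
have c0 : 0 < (2 * T ^+ d)^-1 by rewrite invr_gt0 mulr_gt0// exprn_gt0.
have c1 : (2 * T ^+ d)^-1 <= 1.
  rewrite invf_le1 ?mulr_gt0 ?exprn_gt0//.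
  by have := exprn_ege1 d T1; lra.
have main (v : V) : integral v -> 1 <= `|lsubmx v| -> 0 < h v ->
    (2 * T ^+ d)^-1 / `|lsubmx v| ^+ d <= h v.
  move=> vZ v1 v0; set nv := `|lsubmx v|.
  have nv0 : 0 < nv by exact: lt_le_trans v1.
  have [hv1|hv1] := leP 1 (h v).
    apply: le_trans hv1; rewrite ler_pdivrMr ?exprn_gt0// mul1r (le_trans c1)//.
    exact: exprn_ege1.
  pose r := rho * nv; have r1 : 1 <= r by rewrite -[leLHS]mulr1 ler_pM.
  have r0 : 0 < r by exact: lt_le_trans r1.
  pose X := C * r / 2 + (`|h va| + `|h vb|) * `|f|; pose U := (Num.truncn X).+1.
  have X0 : 0 <= X by rewrite addr_ge0// divr_ge0// mulr_ge0// ltW.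
  have XU : X <= U%:R by rewrite ltW// truncnS_gt.
  have UX : U%:R <= X + 1 by rewrite -natr1 lerD2r truncn_le.
  have La1 : 0 < 1 + La by lra.
  have vr : `|proj_rho (form_map L) (- v)| < om * r.
    have big : (1 + La) * nv < om * r.
      apply: (@lt_le_trans _ _ (w * r)); last first.
        by rewrite ler_pM2r// ge_min lexx.
      rewrite /r /rho mulrA mulrCA divff ?gt_eqF// mulr1 ltr_pM2r//.
      by rewrite ltr_pMr// ltr1n.
    have lN : `|lsubmx (- v)| = nv by rewrite raddfN normrN.
    have nvle : nv <= (1 + La) * nv by rewrite ler_peMl ?(ltW nv0)// lerDl.
    rewrite proj_rhoE; apply: row_mx_norm_lt.
      by rewrite lN (le_lt_trans nvle).
    apply: row_norm_lt => [|i].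
      by rewrite (le_lt_trans _ big)// mulr_ge0// ltW.
    rewrite ord1 mxE eqxx mulr1n (le_lt_trans (LaE _))// lN.
    rewrite (le_lt_trans _ big)//.
    by rewrite ler_pM2r// lerDr.
  have := repetitive_height_bound piE (rep _ r1) r0 vr vZ
    (introT andP (conj v0 hv1)) XU.
  set q := Num.truncn _ => qU.
  (* As [(h v)^-1] exceeds 1, truncation loses at most a factor 2; this is the 2 in
     [(2 * T ^+ d)^-1]. *)
  have hq : (h v)^-1 <= 2 * q%:R.
    have q1 : 1 <= q%:R :> R by rewrite ler1n truncn_gt0 invf_ge1// ltW.
    have := truncnS_gt (h v)^-1; rewrite -/q -natr1; lra.
  have UT : (2 * U + 2)%:R <= T * nv.
    rewrite natrD natrM /T -mulrA -/r.
    have : (X + 2) <= (C / 2 + (`|h va| + `|h vb|) * `|f| + 2) * r.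
      rewrite /X; move: HF0; move: (_ * `|f|) => HF HF0.
      by rewrite !mulrDl !lerD ?ler_peMr// mulrAC.
    rewrite -mulrA; lra.
  rewrite -[leRHS]invrK -invfM lef_pV2 ?posrE ?invr_gt0//; last first.
    by rewrite !mulr_gt0// exprn_gt0.
  rewrite (le_trans hq)// -mulrA ler_pM2l// -exprMn.
  apply: (@le_trans _ _ ((2 * U + 2)%:R ^+ d)); first by rewrite -natrX ler_nat.
  by rewrite lerXn2r// nnegrE ?ler0n// ltW// mulr_gt0.
exists (2 * T ^+ d)^-1 => // n n0; apply: lb_le_inf.
  by exists `|L (map_mx intr n) - 0%:~R|, 0.
move=> _ [p _ <-]; pose v := lattice_point R n p.
have vZ : integral v := lattice_point_integral R n p.
have vl : lsubmx v = map_mx intr n by rewrite row_mxKl.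
have hvE : h v = p%:~R - L (map_mx intr n) by rewrite height_lattice_point.
have n1 : 1 <= `|lsubmx v|.
  rewrite vl; have /rV0Pn[i ni] := n0; apply: le_trans (row_norm_ge _ i).
  by rewrite mxE -intr_norm (_ : 1 = 1%:~R)// ler_int -gtz0_ge1 normr_gt0.
rewrite distrC -hvE -vl.
(* A negative height is treated through [- v]; height 0 would force [v = 0] by aperiodicity, against
   [n != 0]. *)
have [hv0|hv0|hv0] := ltgtP (h v) 0.
- rewrite ltr0_norm//.
  have := main (- v); rewrite !raddfN/= normrN; apply => //.
    exact: int_rowN.
  by rewrite oppr_gt0.
- by rewrite gtr0_norm//; exact: main.
- have := aperiodic_height aper reg wab vZ hv0 => v0; move: n1.
  by rewrite v0 linear0 normr0 ler10.
Qed.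

End RepetitiveToBadly.

Unset Implicit Arguments.

Theorem corollary1p3 (R : realType) (k : nat) (hk : (2 <= k)%N)
    (L : {scalar 'rV[R]_k.-1}) (Y : cut_project (form_map L))
    (hY : cubical_cut_project Y \/ canonical_cut_project Y)
    (Omega : set 'rV[R]_(k.-1 + 1)) (hOmega : patch_shape (form_map L) Omega) :
  linearly_repetitive Y Omega <-> badly_approximable L.
Proof.
have [va [vb [reg aper wab]]] : exists va vb, [/\ regular_cut_project Y,
    aperiodic Y & window_between L (window Y) va vb].
  case: hY => -[reg _ aper ->].
    by exists 0, (axis _ 1); split=> //; exact: cubical_window_between.
  have [va [vb wab]] := canonical_window_between L.
  by exists va, vb.
have [_ bnd _ /nbhs_ballP[om /= om0 near0]] := hOmega.
have Omega_near0 w : w \in physical (form_map L) -> `|w| < om -> Omega w.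
  by move=> wE wom; apply: near0 => //; rewrite row_ballE sub0r normrN.
split.
  exact: (linearly_repetitive_badly_approximable reg aper wab om0 Omega_near0).
have d0 : (0 < k.-1)%N by rewrite -ltnS prednK// ltnW.
apply: (badly_approximable_linearly_repetitive d0 reg wab bnd).
by apply: Omega_near0; rewrite ?mem0v ?normr0.
Qed.
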